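(* There exist a set $X \subset \mathbb{R}$ with $\lambda(X) > 0$ and a Borel probability measure $\mu$ on $\mathbb{R}$ such that $\mu(X + t) = 0$ for every $t \in \mathbb{R}$.
   Context: $\lambda$ denotes Lebesgue outer measure on $\mathbb{R}$; $X$ is not assumed measurable. A Borel probability measure $\mu$ (countably additive) is identified with the outer measure it generates, so $\mu(A)$ makes sense for every $A \subset \mathbb{R}$: $\mu(A) = \inf\{\mu(B) : B \supset A,\ B \text{ Borel}\}$. $X+t=\{x+t : x\in X\}$. The statement is a theorem of ZFC (no extra set-theoretic assumptions). *)

(* Defs.v *)
From HB Require Import structures.
From mathcomp Require Import all_boot all_order all_algebra.
From mathcomp Require Import all_classical all_reals all_analysis.

Set Implicit Arguments.
Unset Strict Implicit.
Unset Printing Implicit Defensive.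
Import Order.TTheory GRing.Theory Num.Theory.
Import numFieldNormedType.Exports.

Local Open Scope classical_set_scope.
Local Open Scope ring_scope.

(* Infimum of the total lengths of the countable covers by intervals ]a, b].
   The set A is arbitrary. *)
Definition lebesgue_outer (R : realType) (A : set R) : \bar R :=
  ((@wlength R idfun)^* A)%mu.

(* Only the values of mu on measurable sets are used: those that the function
   mu takes on other sets carry no information. *)
Definition outer_of_measure d (T : measurableType d) (R : realType)
    (mu : {measure set T -> \bar R}) (A : set T) : \bar R :=
  ereal_inf [set mu B | B in [set B | measurable B /\ A `<=` B]].

Definition translate (R : realType) (A : set R) (t : R) : set R :=
  [set x + t | x in A].

(* Main.v *)
(* Call a set small when all its images under maps to R are null for the uniform
   measure on [0, 1].  Well-order R and let I be the set of the points whose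
   initial segment is small: I is not small, so some f makes f(I) non-null.  Let
   psi(x, y) be the real whose binary digits at the square positions are those of
   y and at the other positions those of x; psi maps the square of the uniform
   measure to a measure which is absolutely continuous for Lebesgue measure.
   By Fubini (Sierpinski's argument), the set of the psi(f i, f j) with i <= j
   is not Lebesgue null, while its points with a given y = f j form the image of
   an initial segment, hence of a small set.

   Let mu be the uniform measure on the Cantor set C of the reals whose digits
   vanish except at the positions k^2 - 1.  Apart from a Lebesgue null set of z
   (Borel-Cantelli), adding an element of C - C to z can change only finitely
   many of the digits of z at square positions, because no long enough block of
   digits that follows a square position is constant.  So the points of
   X + t in C only involve countably many values of y, and mu (X + t) = 0. *)
Require Import Defs.
From HB Require Import structures.
From mathcomp Require Import all_boot all_order all_algebra.
From mathcomp Require Import all_classical all_reals all_analysis.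
From mathcomp Require Import measurable_realfun wochoice.
From mathcomp Require Import zify ring lra.

Set Implicit Arguments.
Unset Strict Implicit.
Unset Printing Implicit Defensive.
Import Order.TTheory GRing.Theory Num.Theory.
Import numFieldNormedType.Exports.

Local Open Scope classical_set_scope.
Local Open Scope ring_scope.

(** * Binary expansions *)

Fixpoint cnt (S : pred nat) (n : nat) : nat :=
  if n is m.+1 then (cnt S m + S m)%N else 0%N.

(** The integer whose binary digits, most significant first, are the [d m] with [m < n] in [S]. *)
Fixpoint code (S : pred nat) (d : nat -> bool) (n : nat) : nat :=
  if n is m.+1 then if S m then ((code S d m).*2 + d m)%N else code S d m
  else 0%N.

Lemma cnt_predT n : cnt predT n = n.
Proof. by elim: n => //= n ->; rewrite addn1. Qed.

Lemma cnt_predC S n : (cnt S n + cnt (predC S) n)%N = n.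
Proof. by elim: n => //= n IH; case: (S n) => /=; lia. Qed.

Lemma leq_cnt S m n : (m <= n)%N -> (cnt S m <= cnt S n)%N.
Proof.
move=> /subnK <-; elim: (n - m)%N => //= k IH; rewrite (leq_trans IH)//.
by rewrite leq_addr.
Qed.

Definition infinitely_often (S : pred nat) := forall n, exists2 m, (n <= m)%N & S m.

Lemma cnt_unbounded S : infinitely_often S -> forall k, exists n, (k <= cnt S n)%N.
Proof.
move=> Sinf; elim=> [|k [n kn]]; first by exists 0%N.
have [m nm Sm] := Sinf n; exists m.+1 => /=; rewrite Sm addn1 ltnS.
exact: leq_trans kn (leq_cnt _ nm).
Qed.

Lemma cnt_surj S : infinitely_often S -> forall k, exists2 n, S n & cnt S n = k.
Proof.
move=> Sinf k; have := cnt_unbounded Sinf k.+1.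
move=> /ex_minnP[[//|n]] /= kn nmin; exists n.
  by case: (S n) nmin kn => // nmin kn; have := nmin n; rewrite addn0 in kn; lia.
by have := nmin n; case: (S n) kn => /=; lia.
Qed.

Lemma eq_code (S : pred nat) (d e : nat -> bool) n :
  (forall m, (m < n)%N -> S m -> d m = e m) ->
  code S d n = code S e n.
Proof.
elim: n => //= n IH E; rewrite IH => [|m mn]; last by apply: E; lia.
by case: ifP => // Sn; rewrite E.
Qed.

Lemma exists_expn_gt (R : realType) (a : R) : exists n, a < 2 ^+ n.
Proof.
exists (Num.truncn a).+1; apply: lt_trans (truncnS_gt _) _.
by rewrite -natrX ltr_nat ltn_expl.
Qed.

Section digits.
Variable R : realType.
Implicit Types (x y z : R) (d : nat -> bool) (S : pred nat).

Lemma normrM_gt0 (a p : R) : 0 < p -> `|a| * p = `|a * p|.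
Proof. by move=> p0; rewrite normrM (gtr0_norm p0). Qed.

(* [Num.truncn] is [0] on negative reals, so that negative reals only have zero
   bits. *)
Definition level (n : nat) x : nat := Num.truncn (2 ^+ n * x).

Definition bit (n : nat) x : bool := odd (level n.+1 x).

Lemma level_neg n x : x < 0 -> level n x = 0%N.
Proof.
by move=> x0; rewrite /level truncn_floor lt_geF// pmulr_rlt0// exprn_gt0.
Qed.

Lemma level_itv n x : 0 <= x -> (level n x)%:R <= 2 ^+ n * x < (level n x).+1%:R.
Proof. by move=> x0; apply: truncn_itv; rewrite mulr_ge0// exprn_ge0. Qed.

Lemma levelS n x : 0 <= x -> level n.+1 x = ((level n x).*2 + bit n x)%N.
Proof.
move=> x0; suff -> : level n x = (level n.+1 x)./2 by rewrite addnC odd_double_half.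
have /andP[l1 l2] := level_itv n.+1 x0.
have E : (level n.+1 x)%:R = (odd (level n.+1 x))%:R + 2 * (level n.+1 x)./2%:R :> R.
  by rewrite -natrM -natrD mul2n odd_double_half.
apply: truncn_def; move: l1 l2; rewrite -!natr1 E exprS -mulrA.
have : (odd (level n.+1 x))%:R <= 1 :> R by case: odd.
have : 0 <= (odd (level n.+1 x))%:R :> R by [].
set u := 2 ^+ n * x => *; apply/andP; split; lra.
Qed.

Lemma level_code n x : 0 <= x < 1 -> level n x = code predT (bit^~ x) n.
Proof.
move=> /andP[x0 x1]; elim: n => [|n IH]; last by rewrite levelS// IH.
by apply: truncn_def; rewrite expr0 mul1r x0.
Qed.

Definition partial S d n : R := (code S d n)%:R / 2 ^+ cnt S n.

(* The real number whose binary expansion lists the [d n], for [n] in [S]. *)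
Definition ev S d : R := sup (range (partial S d)).

(** The dyadic intervals from [code] to [code + 1] over [2 ^+ cnt] are nested: a digit at a position
    in [S] selects one half, any other position changes nothing. *)
Lemma partial_monotone S d m n : (m <= n)%N -> partial S d m <= partial S d n /\
  (code S d n).+1%:R / 2 ^+ cnt S n <= (code S d m).+1%:R / 2 ^+ cnt S m :> R.
Proof.
move=> /subnK <-; elim: (n - m)%N => //= k [IH1 IH2].
set a := code S d (k + m) in IH1 IH2 *; rewrite /partial addSn /= -/a.
case: ifP => Sk; rewrite ?addn0// addn1 exprS.
set p : R := 2 ^+ cnt S (k + m); have p0 : 0 < p by exact: exprn_gt0.
split; [apply: le_trans IH1 _|apply: le_trans IH2].
  have -> : partial S d (k + m) = a.*2%:R / (2 * p).
    by rewrite /partial -/a -/p -mul2n natrM -mulf_div divff// mul1r.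
  by rewrite ler_pM2r ?invr_gt0 ?mulr_gt0// ler_nat; lia.
have -> : a.+1%:R / p = (a.+1).*2%:R / (2 * p).
  by rewrite -mul2n natrM -mulf_div divff// mul1r.
by rewrite ler_pM2r ?invr_gt0 ?mulr_gt0// ler_nat; case: (d _); lia.
Qed.

Lemma partial_le S d m n : partial S d n <= (code S d m).+1%:R / 2 ^+ cnt S m.
Proof.
have sS k : partial S d k <= (code S d k).+1%:R / 2 ^+ cnt S k.
  by rewrite ler_pM2r ?invr_gt0 ?exprn_gt0// ler_nat.
have [mn|/ltnW nm] := leqP m n.
  by apply: le_trans (sS n) _; exact: (partial_monotone _ _ mn).2.
by apply: le_trans (partial_monotone _ _ nm).1 _.
Qed.

Lemma ev_ge S d n : partial S d n <= ev S d.
Proof.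
apply: ub_le_sup; last by exists n.
by exists ((code S d 0).+1%:R / 2 ^+ cnt S 0) => _ [k _ <-]; exact: partial_le.
Qed.

Lemma ev_le S d n : ev S d <= (code S d n).+1%:R / 2 ^+ cnt S n.
Proof.
apply: ge_sup; first by exists (partial S d 0); exists 0%N.
by move=> _ [k _ <-]; exact: partial_le.
Qed.

Lemma ev_ge0 S d : 0 <= ev S d.
Proof. by apply: le_trans (ev_ge S d 0); rewrite /partial mul0r. Qed.

Lemma ev_le1 S d : ev S d <= 1.
Proof. by have := ev_le S d 0; rewrite /= divr1. Qed.

Lemma level_ev d n : infinitely_often (predC d) -> level n (ev predT d) = code predT d n.
Proof.
move=> dinf; apply: truncn_def.
have := ev_ge predT d n; rewrite /partial cnt_predT ler_pdivrMr ?exprn_gt0//.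
rewrite mulrC => ->/=; rewrite mulrC -ltr_pdivlMr ?exprn_gt0//.
(* A zero digit at some [m >= n] puts [ev] in a left half, hence strictly below the right end of the
   interval of order [n]. *)
have [m nm /= /negbTE dm] := dinf n.
apply: le_lt_trans (ev_le predT d m.+1) _.
have := (partial_monotone predT d nm).2; rewrite !cnt_predT.
apply: lt_le_trans; rewrite /= dm addn0 exprS invfM mulrA.
rewrite ltr_pM2r ?invr_gt0 ?exprn_gt0// ltr_pdivrMr// -natrM ltr_nat; lia.
Qed.

Lemma bit_ev d n : infinitely_often (predC d) -> bit n (ev predT d) = d n.
Proof. by move=> dinf; rewrite /bit level_ev//= oddD odd_double; case: (d n). Qed.

Lemma ev_unique S x d : infinitely_often S ->
  (forall n, (code S d n)%:R <= 2 ^+ cnt S n * x <= (code S d n).+1%:R) -> ev S d = x.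
Proof.
move=> Sinf H; apply/eqP; rewrite -subr_eq0 -normr_le0; apply/ler_addgt0Pl => e e0.
have [k ke] := exists_expn_gt e^-1.
have [n kn] := cnt_unbounded Sinf k.
have p0 : 0 < 2 ^+ cnt S n :> R by exact: exprn_gt0.
have pe : 1 < e * 2 ^+ cnt S n.
  rewrite mulrC -ltr_pdivrMr// mul1r (lt_le_trans ke)//.
  by rewrite ler_eXn2l ?ltr1n.
have := ev_ge S d n; have := ev_le S d n; rewrite /partial ler_pdivlMr// ler_pdivrMr//.
have /andP[] := H n; rewrite addr0 -(ler_pM2r p0 `|_|) normrM_gt0// ler_norml.
rewrite -[(code _ _ _).+1%:R]natr1; move: pe; move: (2 ^+ _) => p *.
by apply/andP; split; lra.
Qed.

Lemma bit_neg n x : x < 0 -> bit n x = false.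
Proof. by move=> x0; rewrite /bit level_neg. Qed.

Lemma bit_infinitely_often0 x : infinitely_often (fun n => ~~ bit n x).
Proof.
have [x0 k|x0 n] := leP 0 x; last by exists n; rewrite ?bit_neg.
apply: contrapT => H; have {}H m : (k <= m)%N -> bit m x.
  by move=> km; apply: contrapT => /negP ?; apply: H; exists m.
have lv j : (level (j + k) x).+1 = ((level k x).+1 * 2 ^ j)%N.
  by elim: j => [|j IH]; rewrite ?muln1// addSn levelS// H ?leq_addl// expnS; lia.
(* The gap [e] up to the next integer doubles with each digit 1; once it exceeds 1,
   [level (j + k) x] is larger than [2 ^+ (j + k) * x]. *)
have /andP[_] := level_itv k x0; rewrite -subr_gt0; set e := _ - _ => e0.
have [j] := exists_expn_gt e^-1.
rewrite -[e^-1]mul1r ltr_pdivrMr// [_ * e]mulrC => je.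
have /andP[+ _] := level_itv (j + k) x0.
suff : 2 ^+ (j + k) * x < (level (j + k) x)%:R by move=> /lt_le_trans/[apply]; rewrite ltxx.
rewrite -(ltrD2r 1) natr1 lv natrM natrX exprD -mulrA.
by move: je; rewrite /e; set p := 2 ^+ j; set u := 2 ^+ k * x; nra.
Qed.

(** The difference of the levels doubles at each common digit. Hence only countably many nonnegative
    reals share their late digits with a given one. *)
Lemma eventually_eq_bits x y k : 0 <= x -> 0 <= y ->
  (forall j, (k <= j)%N -> bit j x = bit j y) ->
  y = x + ((level k y)%:R - (level k x)%:R) / 2 ^+ k.
Proof.
move=> x0 y0 xy; set c := (level k y)%:R - (level k x)%:R.
have lv j : (level (j + k) y)%:R - (level (j + k) x)%:R = 2 ^+ j * c :> R.
  elim: j => [|j IH]; first by rewrite mul1r.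
  rewrite addSn !levelS// xy ?leq_addl// exprS -mulrA -IH -!addnn !natrD.
  by rewrite mulrBr; ring.
apply/eqP; rewrite -subr_eq0 -normr_le0; apply/ler_addgt0Pl => e e0; rewrite addr0.
have [j] := exists_expn_gt e^-1.
rewrite -[e^-1]mul1r ltr_pdivrMr// [_ * e]mulrC => je.
have pk1 : 1 <= 2 ^+ k :> R by exact/exprn_ege1/ler1n.
have p0 : 0 < 2 ^+ (j + k) :> R by exact: exprn_gt0.
rewrite -(ler_pM2r p0) normrM_gt0//.
have -> : (y - (x + c / 2 ^+ k)) * 2 ^+ (j + k) =
    2 ^+ (j + k) * y - 2 ^+ (j + k) * x - 2 ^+ j * c.
  by rewrite !exprD; field; rewrite gt_eqF// (lt_le_trans _ pk1).
rewrite -lv.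
have /andP[] := level_itv (j + k) x0; have /andP[] := level_itv (j + k) y0.
rewrite -[(level _ y).+1%:R]natr1 -[(level _ x).+1%:R]natr1 => h1 h2 h3 h4.
have : 1 <= e * 2 ^+ (j + k) by rewrite exprD mulrA; nra.
rewrite ler_norml; move: h1 h2 h3 h4 {p0}; move: (2 ^+ (j + k)) => p *.
by apply/andP; split; lra.
Qed.

End digits.
Arguments bit {R} n x.

(** * Interleaved and sparse expansions *)

Definition mix (S : pred nat) (d e : nat -> bool) (n : nat) : bool :=
  if S n then e (cnt S n) else d (cnt (predC S) n).

Definition spread (S : pred nat) (d : nat -> bool) (n : nat) : bool :=
  S n && d (cnt S n).

Lemma lt_cnt (S : pred nat) m n : S m -> (m < n)%N -> (cnt S m < cnt S n)%N.
Proof.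
by move=> Sm mn; apply: leq_trans (leq_cnt S mn); rewrite /= Sm addn1.
Qed.

Lemma mix_infinitely_often0 (S : pred nat) (d e : nat -> bool) :
  infinitely_often S -> infinitely_often (predC e) ->
  infinitely_often (predC (mix S d e)).
Proof.
move=> Sinf einf n; have [k nk ek] := einf (cnt S n).
have [m Sm mk] := cnt_surj Sinf k; exists m; last by rewrite /= /mix Sm mk.
by rewrite leqNgt; apply/negP => /(lt_cnt Sm); lia.
Qed.

(** Puts a cylinder of interleaved digits inside a product of two cylinders, with [n] digits in all
    by [cnt_predC]. *)
Lemma code_mix_inj (S : pred nat) (d e d' e' : nat -> bool) n :
  code predT (mix S d e) n = code predT (mix S d' e') n ->
  code predT e (cnt S n) = code predT e' (cnt S n) /\
  code predT d (cnt (predC S) n) = code predT d' (cnt (predC S) n).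
Proof.
elim: n => //= n IH E.
have [] : mix S d e n = mix S d' e' n /\
    code predT (mix S d e) n = code predT (mix S d' e') n.
  by case: (mix S d e n) (mix S d' e' n) E => -[]; lia.
rewrite {1 2}/mix; case: (S n) => Em /IH[Ee Ed]; rewrite ?(addn1, addn0)/=.
all: by rewrite Ee Ed Em.
Qed.

Lemma code_spread (S : pred nat) d n :
  code S (spread S d) n = code predT d (cnt S n).
Proof.
elim: n => //= n IH; case: ifP => Sn; rewrite ?addn0// addn1 /=.
by rewrite IH /spread Sn.
Qed.

Lemma infinitely_oftenW (S T : pred nat) :
  subpred S T -> infinitely_often S -> infinitely_often T.
Proof. by move=> ST Sinf n; have [m nm /ST Tm] := Sinf n; exists m. Qed.

(** * Square positions and the positions just before them *)

Definition square : pred nat := fun n => `[< exists k, n = (k * k)%N >].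

Lemma squareMM k : square (k * k).
Proof. by apply/asboolP; exists k. Qed.

Lemma between_squares k n : (k * k < n < k.+1 * k.+1)%N -> square n = false.
Proof.
move=> kn; apply/negP => /asboolP[j nj]; subst n.
have [jk|kj] := leqP j k.
  by have : (j * j <= k * k)%N by [exact: leq_mul]; lia.
by have : (k.+1 * k.+1 <= j * j)%N by [exact: leq_mul]; lia.
Qed.

Lemma square_infinitely_often : infinitely_often square.
Proof. by move=> n; exists (n * n)%N; [case: n => // n; nia|exact: squareMM]. Qed.

(** The positions [k^2 - 1]: each gap between two of them begins at a square. *)
Definition presquare : pred nat := fun n => square n.+1.

Lemma presquare_infinitely_often : infinitely_often presquare.
Proof.
move=> n; exists (n.+1 * n.+1).-1; first by nia.
exact: squareMM n.+1.
Qed.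

Lemma not_presquare_infinitely_often : infinitely_often (predC presquare).
Proof.
move=> n; exists (n.+1 * n.+1)%N; first by nia.
by rewrite /= /presquare (@between_squares n.+1)//; nia.
Qed.

(** * Interleaved reals and translates of the Cantor set *)

Section real_codes.
Variable R : realType.
Implicit Types x y z u t : R.

Definition interleave x y : R :=
  ev R predT (mix square (bit^~ x) (bit^~ y)).

Definition embed u : R := ev R predT (spread presquare (bit^~ u)).

Definition extract z : R := ev R presquare (bit^~ z).

Lemma interleave_infinitely_often0 x y :
  infinitely_often (predC (mix square (bit^~ x) (bit^~ y))).
Proof.
apply: mix_infinitely_often0; first exact: square_infinitely_often.
exact: bit_infinitely_often0.
Qed.

Lemma bit_interleave x y n :
  bit n (interleave x y) = mix square (bit^~ x) (bit^~ y) n.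
Proof. by rewrite bit_ev//; exact: interleave_infinitely_often0. Qed.

Lemma level_interleave x y x' y' n :
  level n (interleave x y) = level n (interleave x' y') ->
  code predT (bit^~ y) (cnt square n) = code predT (bit^~ y') (cnt square n) /\
  code predT (bit^~ x) (cnt (predC square) n) =
  code predT (bit^~ x') (cnt (predC square) n).
Proof.
rewrite !level_ev; try exact: interleave_infinitely_often0.
exact: code_mix_inj.
Qed.

Lemma bit_embed u n : bit n (embed u) = spread presquare (bit^~ u) n.
Proof.
rewrite bit_ev//; apply: infinitely_oftenW not_presquare_infinitely_often.
by move=> m /= /negbTE pm; rewrite /spread pm.
Qed.

Lemma embedK u : 0 <= u < 1 -> extract (embed u) = u.
Proof.
move=> u01; have /andP[u0 _] := u01.
apply: ev_unique; first exact: presquare_infinitely_often.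
move=> n; rewrite (eq_code (e := spread presquare (bit^~ u))); last first.
  by move=> m _ _; exact: bit_embed.
rewrite code_spread -level_code//.
by have /andP[-> /ltW] := level_itv (cnt presquare n) u0.
Qed.

(** The position in [presquare] after [k^2 - 1] is [k^2 + 2k], so the digits at [k^2], ...,
    [k^2 + k] vanish: the first gives the parity, the [k] others the bound [2 ^- k]. *)
Lemma level_embed u k : (0 < k)%N ->
  ~~ odd (level (k * k).+1 (embed u)) /\
  (level (k * k).+1 (embed u))%:R <= 2 ^+ (k * k).+1 * embed u
    < (level (k * k).+1 (embed u))%:R + 2 ^- k.
Proof.
move=> k0; have c0 : 0 <= embed u by exact: ev_ge0.
split.
  by rewrite -/(bit _ _) bit_embed /spread /presquare (@between_squares k)//; nia.
have /andP[-> _] /= := level_itv (k * k).+1 c0.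
have lv j : (j <= k)%N ->
    level (j + (k * k).+1) (embed u) = (2 ^ j * level (k * k).+1 (embed u))%N.
  elim: j => [|j IH] jk; first by rewrite mul1n.
  rewrite addSn levelS// IH ?(ltnW jk)// bit_embed /spread /presquare.
  by rewrite (@between_squares k) ?expnS; nia.
have /andP[_] := level_itv (k + (k * k).+1) c0.
rewrite lv// exprD -[(_ * _).+1%:R]natr1 natrM natrX -mulrA; set L := _%:R; set c := _ * embed u.
have p0 : 0 < 2 ^+ k :> R by exact: exprn_gt0.
by rewrite -(ltr_pM2l p0 c) mulrDr divff ?gt_eqF.
Qed.

(** Up to a boundary case, the [k] digits of [z >= 0] after position [k^2] are all equal, so that a
    carry could run through them to the digit at [k^2]. *)
Definition near_dyadic k z := exists m : nat, `|2 ^+ (k * k).+1 * z - m%:R| < 2 ^- k.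

(* Translating by a difference of two points of the range of [embed] changes
   [2 ^ (k^2 + 1) * z] by an even integer, up to an error below [2 ^ - k]. *)
Lemma bit_translate z z' u u' k : (0 < k)%N -> 0 <= z -> 0 <= z' ->
  z - z' = embed u - embed u' -> ~ near_dyadic k z' ->
  bit (k * k) z = bit (k * k) z'.
Proof.
move=> k0 z0 z'0 E nnear; rewrite /bit.
have [oL] := level_embed u k0; have [oL'] := level_embed u' k0.
have := level_itv (k * k).+1 z0; have := level_itv (k * k).+1 z'0.
have Ez : 2 ^+ (k * k).+1 * z = 2 ^+ (k * k).+1 * z'
    + 2 ^+ (k * k).+1 * embed u - 2 ^+ (k * k).+1 * embed u'.
  by rewrite -addrA -mulrBr -E; ring.
rewrite Ez; move: nnear; rewrite /near_dyadic.
move: oL oL'; set n := level _ z; set n' := level _ z'.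
set L := level _ (embed u); set L' := level _ (embed u').
move: (2 ^+ _ * z') (2 ^+ _ * embed u) (2 ^+ _ * embed u') (2 ^- k) => a c c' e.
move=> oL oL' nnear /andP[a1 a2] /andP[b1 b2] /andP[c1 c2] /andP[d1 d2].
(* [a] stays at distance at least [e] from the integers around it, while [c - L] and [c' - L'] lie
   in [[0, e)]: adding their difference keeps the integer part. *)
have h1 : n'%:R + e <= a.
  rewrite leNgt; apply/negP => h; apply: nnear; exists n'.
  by rewrite ltr_norml; apply/andP; split; lra.
have h2 : a <= n'%:R + 1 - e.
  rewrite leNgt; apply/negP => h; apply: nnear; exists n'.+1.
  by move: a2; rewrite -natr1 ltr_norml => a2; apply/andP; split; lra.
have : (n + L' < n'.+1 + L)%N.
  by rewrite -(ltr_nat R) !natrD -[n'.+1%:R]natr1; lra.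
have : (n' + L < n.+1 + L')%N.
  by move: b2; rewrite -(ltr_nat R) !natrD -[n.+1%:R]natr1; lra.
rewrite !addSn !ltnS => h3 h4.
have : (n + L' = n' + L)%N by apply/eqP; rewrite eqn_leq h4.
by move=> /(congr1 odd); rewrite !oddD (negbTE oL) (negbTE oL') !addbF.
Qed.

Definition near_dyadic_io z := forall n, exists2 k, (n <= k)%N & near_dyadic k z.

(** Two such points differ by a difference of values of [embed], so by [bit_translate] their digits
    at all large squares agree; [F] enumerates the dyadic translates of one fixed [y0]. *)
Lemma fiber_countable t : exists F : nat -> R, forall x y u,
  0 <= y -> ~ near_dyadic_io (interleave x y) ->
  interleave x y + t = embed u -> exists n, F n = y.
Proof.
have [[x0 [y0 [u0 [y00 nd0 E0]]]]|none] := pselect (exists x y u,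
    [/\ 0 <= y, ~ near_dyadic_io (interleave x y) & interleave x y + t = embed u]);
  last first.
  by exists (fun=> 0) => x y u *; exfalso; apply: none; exists x, y, u.
exists (fun n => if unpickle n is Some (k, a, b) then y0 + (a%:R - b%:R) / 2 ^+ k else 0).
move=> x y u y_ge0 _ E.
have [k0 k0P] : exists k0, forall k, (k0 <= k)%N -> ~ near_dyadic k (interleave x0 y0).
  apply: contrapT => H; apply: nd0 => n; apply: contrapT => H'; apply: H.
  by exists n => k nk knear; apply: H'; exists k.
(* With this [K], the digits of [y] of index at least [K] sit at squares [k^2] with [k > k0]. *)
pose K := cnt square (k0.+1 * k0.+1).
exists (pickle (K, level K y, level K y0)); rewrite pickleK.
rewrite -(@eventually_eq_bits R y0 y K)// => j Kj.
have [n sn nj] := cnt_surj square_infinitely_often j.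
have /asboolP[k nk] := sn.
have k0k : (k0 < k)%N.
  rewrite ltnNge; apply/negP => kk0; move: Kj; rewrite /K -nj leqNgt => /negP; apply.
  by apply: lt_cnt => //; subst n; nia.
have := @bit_translate (interleave x y) (interleave x0 y0) u u0 k.
rewrite -nk !bit_interleave /mix sn nj => -> //.
- by lia.
- exact: ev_ge0.
- exact: ev_ge0.
- by rewrite -E -E0; ring.
- by apply: k0P; lia.
Qed.

End real_codes.

(** * Measurability and laws *)

Section measurability.
Variable R : realType.
Local Notation RR := (measurableTypeR R).

Lemma measurable_bit n : measurable_fun [set: RR] (bit n : RR -> bool).
Proof.
apply: (measurable_fun_bool true); rewrite setTI.
have p0 : 0 < 2 ^+ n.+1 :> R by exact: exprn_gt0.
rewrite [X in measurable X](_ : _ = \bigcup_k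
    `[(k.*2.+1)%:R / 2 ^+ n.+1, (k.*2.+2)%:R / 2 ^+ n.+1[%classic); last first.
  apply/seteqP; split => [x /=|x [k _ /=]]; rewrite /bit.
    set m := level _ x => om; exists (m./2) => //=.
    have m0 : m./2.*2.+1 = m by have := odd_double_half m; lia.
    rewrite m0 in_itv/= ler_pdivrMr// ltr_pdivlMr// [x * _]mulrC; apply: truncn_itv.
    rewrite mulr_ge0 ?(ltW p0)// leNgt; apply/negP => x0.
    by have := bit_neg n x0; rewrite /bit -/m om.
  rewrite in_itv/= ler_pdivrMr// ltr_pdivlMr// [x * _]mulrC => /truncn_def.
  by rewrite -/(level _ _) => -> /=; rewrite odd_double.
by apply: bigcup_measurable => k _; exact: measurable_itv.
Qed.

Lemma measurable_code d (T : measurableType d) (S : pred nat)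
    (b : T -> nat -> bool) n :
  (forall n, measurable_fun setT (b ^~ n)) ->
  measurable_fun setT (fun x => (code S (b x) n)%:R : RR).
Proof.
move=> mb; elim: n => [|n IH] /=; first exact: measurable_cst.
case: (S n) => //.
rewrite (_ : (fun x => _) = (fun x => ((code S (b x) n)%:R + (code S (b x) n)%:R : RR)
    + (if b x n then 1 else 0))); last first.
  by apply/funext => x; rewrite -addnn !natrD; case: (b x n).
apply: measurable_funD; first exact: measurable_funD.
by apply: measurable_fun_ifT => //; exact: measurable_cst.
Qed.

Lemma measurable_ev d (T : measurableType d) (S : pred nat)
    (b : T -> nat -> bool) :
  (forall n, measurable_fun setT (b ^~ n)) ->
  measurable_fun setT (fun x => ev R S (b x) : RR).
Proof.
(* [sups] from index 0 is the supremum of all the partial sums, each of them measurable. *)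
move=> mb; rewrite (_ : (fun x => _) =
    (fun x => sups ((fun n x => partial R S (b x) n) ^~ x) 0)); last first.
  apply/funext => x; rewrite /sups/= /sdrop /ev; congr sup.
  by apply/seteqP; split => _ [n _ <-]; exists n.
apply: measurable_fun_sups => [x _|n].
  by exists ((code S (b x) 0).+1%:R / 2 ^+ cnt S 0) => _ [n _ <-]; exact: partial_le.
rewrite /partial; apply: measurable_funM; last exact: measurable_cst.
exact: measurable_code.
Qed.

Lemma measurable_embed : measurable_fun [set: RR] (@embed R : RR -> RR).
Proof.
apply: measurable_ev => n; rewrite /spread.
by case: (presquare n) => /=; [exact: measurable_bit|exact: measurable_cst].
Qed.

Lemma measurable_extract : measurable_fun [set: RR] (@extract R : RR -> RR).
Proof. by apply: measurable_ev => n; exact: measurable_bit. Qed.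

Lemma measurable_interleave :
  measurable_fun [set: (RR * RR)%type] (fun p => interleave p.1 p.2 : RR).
Proof.
apply: measurable_ev => n; rewrite /mix; case: (square n).
  by apply: measurableT_comp measurable_snd; exact: measurable_bit.
by apply: measurableT_comp measurable_fst; exact: measurable_bit.
Qed.

Lemma measurable_cylinder k c :
  measurable [set x : RR | code predT (bit^~ x) k = c].
Proof.
rewrite (_ : [set x | _] = setT `&`
    (fun x => (code predT (bit^~ x) k)%:R : RR) @^-1` [set c%:R]); last first.
  rewrite setTI; apply/seteqP; split => x /= => [->//|/eqP].
  by rewrite eqr_nat => /eqP.
by apply: measurable_code => // n; exact: measurable_bit.
Qed.

Lemma measurable_level n c : measurable [set x : RR | level n x = c].
Proof.
have p0 : 0 < 2 ^+ n :> R by exact: exprn_gt0.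
have -> : [set x : RR | level n x = c] =
    (if c == 0%N then [set` `]-oo, 0[] else set0) `|`
    `[c%:R / 2 ^+ n, c.+1%:R / 2 ^+ n[%classic.
  apply/seteqP; split => x /=; rewrite ?in_itv/= ler_pdivrMr// ltr_pdivlMr// [x * _]mulrC.
    have [x0 <-|x0] := leP 0 x.
      by right; apply: truncn_itv; rewrite mulr_ge0// ltW.
    rewrite level_neg// => <-; left.
    by rewrite /= in_itv.
  case=> [|/truncn_def//]; case: eqP => // -> /=.
  by rewrite in_itv/=; exact: level_neg.
by apply: measurableU => //; case: ifP.
Qed.

End measurability.

(** * The uniform measure and the law of an interleaved pair *)

Section uniform_law.
Variable R : realType.
Local Notation RR := (measurableTypeR R).

Definition uniform01 : probability RR R := uniform_prob (@ltr01 R).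

Local Notation unif := uniform01.

Lemma unifE (A : set RR) : measurable A -> unif A = lebesgue_measure (A `&` `[0, 1]).
Proof.
move=> mA; rewrite /uniform01 /= /uniform_prob integral_uniform_pdf.
rewrite (eq_integral (fun=> 1%:E)) ?integral_cst ?mul1e//.
  exact: measurableI.
move=> x; rewrite inE /= => -[_]; rewrite in_itv /= => x01.
by rewrite /uniform_pdf x01 subr0 invr1.
Qed.

Lemma unif_set1 (a : RR) : unif [set a] = 0%E.
Proof.
rewrite unifE//; apply/eqP; rewrite -measure_le0.
by rewrite -(lebesgue_measure_set1 (a : R)) le_measure ?inE//; exact: measurableI.
Qed.

Lemma unif_outside : unif.-negligible (~` `[0, 1[).
Proof.
exists (~` `[0, 1[); split => //; first exact: measurableC.
rewrite unifE; last exact: measurableC.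
apply/eqP; rewrite -measure_le0 -(lebesgue_measure_set1 (1 : R)) le_measure ?inE//.
  by apply: measurableI => //; exact: measurableC.
move=> x /= [+ /[!in_itv]/= /andP[x0 x1]]; rewrite in_itv/= x0/= => /negP.
by rewrite -leNgt => x1'; apply/eqP; rewrite eq_le x1 x1'.
Qed.

Lemma unif_cylinder k c :
  (unif [set x | code predT (bit^~ x) k = c] <= (2 ^- k)%:E)%E.
Proof.
have p0 : 0 < 2 ^+ k :> R by exact: exprn_gt0.
have mc := @measurable_cylinder R k c.
rewrite unifE//.
(* The digits of 1 are all zero, so 1 may belong to the cylinder without lying in the dyadic
   interval; it is added as a null singleton. *)
apply: (@le_trans _ _ (lebesgue_measure
    (`[c%:R / 2 ^+ k, c.+1%:R / 2 ^+ k] `|` [set 1] : set RR))).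
  rewrite le_measure ?inE//; [exact: measurableI|exact: measurableU|].
  move=> x /= [xc /[!in_itv]/= /andP[x0]]; rewrite le_eqVlt => /orP[/eqP->|x1].
    by right.
  left; rewrite /= ler_pdivrMr// ler_pdivlMr// [x * _]mulrC.
  by rewrite -xc -level_code ?x0//; have /andP[-> /ltW] := level_itv k x0.
apply: le_trans (measureU2 _ _ _) _ => //.
have /= -> := lebesgue_measure_set1 (1 : R); rewrite adde0 lebesgue_measure_itv/=.
case: ifPn => _; last by rewrite lee_fin invr_ge0 ltW.
by rewrite -EFinD lee_fin -mulrBl -natr1 addrAC subrr add0r mul1r.
Qed.

Local Notation unif2 := (unif \x unif)%E.

Lemma unif2_level_interleave n c :
  (unif2 [set p | level n (interleave p.1 p.2) = c] <= (2 ^- n)%:E)%E.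
Proof.
have mL : measurable [set p : RR * RR | level n (interleave p.1 p.2) = c].
  have := @measurable_interleave R measurableT _ (measurable_level n c).
  by rewrite setTI.
have [[[x0 y0] /= xy0]|none] :=
    pselect (exists p : RR * RR, level n (interleave p.1 p.2) = c); last first.
  rewrite (_ : [set p | _] = set0) ?measure0 ?lee_fin ?invr_ge0 ?exprn_ge0//.
  by apply/seteqP; split => p //= pc; apply: none; exists p.
pose A := [set x : RR | code predT (bit^~ x) (cnt (predC square) n) =
  code predT (bit^~ x0) (cnt (predC square) n)].
pose B := [set y : RR | code predT (bit^~ y) (cnt square n) =
  code predT (bit^~ y0) (cnt square n)].
have mA : measurable A by exact: measurable_cylinder.
have mB : measurable B by exact: measurable_cylinder.
apply: (@le_trans _ _ (unif2 (A `*` B))).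
  apply: le_measure; rewrite ?inE//; first exact: measurableX.
  by move=> [x y] /= xyc; have [] := @level_interleave R x y x0 y0 n _; rewrite ?xy0.
rewrite product_measure1E// -[in leRHS](cnt_predC square n) addnC exprD invfM EFinM.
by apply: lee_pmul => //; exact: unif_cylinder.
Qed.

End uniform_law.

(** * Absolute continuity, Borel-Cantelli and Fubini *)

Section null_sets.
Variable R : realType.
Local Notation RR := (measurableTypeR R).
Local Notation unif := (uniform01 R).
Local Notation unif2 := (unif \x unif)%E.
Local Notation psi := (fun p : RR * RR => interleave p.1 p.2 : RR).

Lemma measurable_preimage_interleave (A : set RR) :
  measurable A -> measurable (psi @^-1` A).
Proof.
by move=> mA; have := @measurable_interleave R measurableT _ mA; rewrite setTI.
Qed.

Lemma level_increment n (a b : R) : a < b ->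
  (level n b)%:R - (level n a)%:R <= 2 ^+ n * (b - a) + 1.
Proof.
move=> ab; have p0 : 0 < 2 ^+ n :> R by exact: exprn_gt0.
rewrite mulrBr; have pab : 2 ^+ n * a < 2 ^+ n * b by rewrite ltr_pM2l.
have [b0|/level_neg->] := leP 0 b; last by have := ler0n R (level n a); lra.
have /andP[lb _] := level_itv n b0.
have [/(level_itv n)/andP[_]|a0] := leP 0 a.
  by rewrite -[(level n a).+1%:R]natr1; lra.
have : 2 ^+ n * a < 0 by rewrite pmulr_rlt0.
by rewrite (level_neg n a0); lra.
Qed.

(** With [2^n (b - a) > 1], at most [2^n (b - a) + 2], hence at most [3 * 2^n (b - a)], levels of
    order [n] meet the interval, and each has measure at most [2^-n]. *)
Lemma unif2_interleave_itv (a b : R) : a < b ->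
  (unif2 (psi @^-1` `]a, b[) <= (3 * (b - a))%:E)%E.
Proof.
move=> ab; have [n nab] := exists_expn_gt (b - a)^-1.
have p0 : 0 < 2 ^+ n :> R by exact: exprn_gt0.
pose L c := psi @^-1` [set z : RR | level n z = c].
have mL c : measurable (L c).
  by apply: measurable_preimage_interleave; exact: measurable_level.
pose k := (level n b - level n a).+1.
have lab : (level n a <= level n b)%N by apply: le_truncn; rewrite ler_pM2l// ltW.
apply: (@le_trans _ _ (\sum_(i < k) unif2 (L (level n a + i)%N)))%E.
  apply: (@content_subadditive _ _ _ unif2 _ (fun i => L (level n a + i)%N)) => //.
    by apply: measurable_preimage_interleave; exact: measurable_itv.
  move=> p /=; rewrite in_itv/= => /andP[ap pb].
  rewrite -(bigcup_mkord k (fun i => L (level n a + i)%N)).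
  exists (level n (psi p) - level n a)%N => /=.
    rewrite /k ltnS leq_sub2r//; apply: le_truncn; rewrite ler_pM2l//; exact: ltW.
  by rewrite /L /= subnKC//; apply: le_truncn; rewrite ler_pM2l//; exact: ltW.
apply: (@le_trans _ _ (\sum_(i < k) (2 ^- n)%:E))%E.
  by apply: lee_sum => i _; exact: unif2_level_interleave.
rewrite sumEFin lee_fin sumr_const card_ord -[_ *+ k]mulr_natl ler_pdivrMr//.
have := level_increment n ab; rewrite -natrB// /k -[(_ - _).+1%:R]natr1.
move: nab; rewrite -[(b - a)^-1]mul1r ltr_pdivrMr ?subr_gt0//.
by move: (2 ^+ n) ((_ - _)%N%:R) => p q; lra.
Qed.

(** The bound on intervals passes to open covers; a null set has covers of total length below
    [e / 3]. *)
Lemma unif2_interleave_null (N : set RR) : lebesgue_measure.-negligible N ->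
  unif2.-negligible (psi @^-1` N).
Proof.
move=> [M [mM M0 NM]]; exists (psi @^-1` M); split => //.
- exact: measurable_preimage_interleave.
- apply/eqP; rewrite -measure_le0; apply/lee_addgt0Pr => e e0; rewrite add0e.
  have /negligible_outer_measure lM : lebesgue_measure.-negligible M by exact/negligibleP.
  have [F [Fitv MF] Fe] : exists2 F, open_itv_cover M F &
      (\sum_(0 <= k <oo) wlength idfun (F k) < (e / 3)%:E)%E.
    have e3 : 0 < e / 3 by rewrite divr_gt0.
    move: lM; rewrite outer_measure_open_itv_cover => lM.
    have := @lb_ereal_inf_adherent R _ _ e3; move: lM; set S := [set _ | _ in _] => lM /(_ S).
    by rewrite lM => /(_ isT)[_ [F MF <-]]; rewrite add0e => ?; exists F.
  apply: (@le_trans _ _ (\sum_(0 <= k <oo) (unif2 (psi @^-1` (F k))))%E).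
    apply: measure_sigma_subadditive.
    + move=> k; apply: measurable_preimage_interleave.
      have [[a b] ->] := Fitv k.
      by have : measurable (`]a, b[%classic : set RR) by exact: measurable_itv.
    + exact: measurable_preimage_interleave.
    + by move=> p /MF[k _ Fk]; exists k.
  apply: (@le_trans _ _ (\sum_(0 <= k <oo) 3%:E * wlength idfun (F k))%E).
    apply: lee_nneseries => [//|k _].
    have [[a b] ->] := Fitv k; rewrite wlength_itv/=.
    case: ifPn => [|ab]; first by rewrite lte_fin => ab; exact: unif2_interleave_itv.
    rewrite mule0 (_ : _ @^-1` _ = set0) ?measure0//.
    apply/seteqP; split => // p /=; rewrite in_itv/= => /andP[ap pb].
    by move: ab; rewrite lte_fin (lt_trans ap pb).
  rewrite nneseriesZl//.
  apply: (@le_trans _ _ (3%:E * (e / 3)%:E)%E).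
    by rewrite lee_pmul2l// ltW.
  by rewrite -EFinM lee_fin; lra.
- by move=> p; exact: NM.
Qed.

(** Borel-Cantelli: in [[0, 1]], rank [k] is covered by [2^(k^2+1) + 1] intervals of length at most
    [2 * 2^-k / 2^(k^2+1)], in total at most [4 * 2^-k = 8 / 2^(k+1)]. *)
Lemma near_dyadic_io_null :
  (lebesgue_measure : set RR -> \bar R).-negligible
    [set z : RR | 0 <= z <= 1 /\ near_dyadic_io z].
Proof.
pose I k m : set RR :=
  `](m%:R - 2 ^- k) / 2 ^+ (k * k).+1, (m%:R + 2 ^- k) / 2 ^+ (k * k).+1[%classic.
pose G k := \big[setU/set0]_(m < (2 ^ (k * k).+1).+1) I k m.
have mG k : measurable (G k) by apply: bigsetU_measurable => m _; exact: measurable_itv.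
exists (lim_sup_set G); split.
- apply: bigcap_measurable => // n _.
  by apply: bigcup_measurable => k _; exact: mG.
- apply: lim_sup_set_cvg0 => //.
  apply: (@le_lt_trans _ _ (\sum_(0 <= k <oo) (8 / (2 ^ (k + 1))%:R)%:E)%E).
    apply: lee_nneseries => [//|k _]; rewrite /G.
    apply: le_trans.
      apply: (@Boole_inequality _ _ _ lebesgue_measure (I k)).
      by move=> i _; exact: measurable_itv.
    set p : R := 2 ^+ (k * k).+1; have p0 : 0 < p by exact: exprn_gt0.
    have q0 : 0 < 2 ^- k :> R by rewrite invr_gt0 exprn_gt0.
    apply: (@le_trans _ _ (\sum_(i < (2 ^ (k * k).+1).+1) (2 * 2 ^- k / p)%:E)%E).
      apply: lee_sum => i _; rewrite /I /= lebesgue_measure_itv/=.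
      case: ifPn => _; last by rewrite lee_fin divr_ge0 ?mulr_ge0 ?ltW.
      by rewrite -EFinD lee_fin -mulrBl ler_pM2r ?invr_gt0//; lra.
    rewrite sumEFin lee_fin sumr_const card_ord -[_ *+ _.+1]mulr_natl.
    rewrite -[(2 ^ (k * k).+1).+1%:R]natr1 natrX -/p.
    rewrite addn1 expnS natrM natrX invfM mulrA ler_pdivrMr// mulrAC.
    have p1 : 1 <= p by exact/exprn_ege1/ler1n.
    by move: (2 ^- k) q0 => q q0; nra.
  by rewrite (cvg_lim _ (@cvg_geometric_eseries_half R 8 0))// ltry.
- move=> z [/andP[z0 z1] zio] n _ /=.
  have [k nk [m zm]] := zio n; exists k => //.
  have p0 : 0 < 2 ^+ (k * k).+1 :> R by exact: exprn_gt0.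
  rewrite /G -(bigcup_mkord _ (I k)); move: zm; rewrite ltr_norml => /andP[zm1 zm2].
  exists m => /=; last first.
    rewrite /I /= ?in_itv/= ltr_pdivrMr// ltr_pdivlMr// [z * _]mulrC.
    by apply/andP; split; lra.
  have : m%:R < 2 ^+ (k * k).+1 + 1 :> R.
    have : 2 ^+ (k * k).+1 * z <= 2 ^+ (k * k).+1 :> R by rewrite ler_piMr// ltW.
    have : 2 ^- k <= 1 :> R by rewrite invf_le1 ?exprn_gt0//; exact/exprn_ege1/ler1n.
    by move: zm1; move: (2 ^- k) (2 ^+ (k * k).+1) (2 ^+ _ * z) => *; lra.
  by rewrite -natrX natr1 ltr_nat.
Qed.

(** Fubini for a measurable null set [H] containing [G]; [Z] collects the [x] at which the section
    of [H] is not null. *)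
Lemma negligible_xsection (G : set (RR * RR)) : unif2.-negligible G ->
  exists2 Z, unif.-negligible Z &
    forall x, ~ Z x -> unif.-negligible [set y | G (x, y)].
Proof.
move=> [H [mH H0 GH]]; exists [set x | unif (xsection H x) != 0%E].
  have mx : measurable_fun setT (unif \o xsection H) by exact: measurable_fun_xsection.
  have /(ae_eq_integral_abs unif measurableT mx) :
      (\int[unif]_x `|(unif \o xsection H) x| = 0)%E.
    rewrite -[RHS]H0 /product_measure1; apply: eq_integral => x _.
    by rewrite gee0_abs.
  move=> [B [mB B0 HB]]; exists B; split => // x /= Hx; apply: HB => /=.
  by move=> /(_ I) Hx0; move: Hx; rewrite Hx0 eqxx.
move=> x /= /negP/negPn/eqP Hx; exists (xsection H x); split => //.
  exact: measurable_xsection.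
by move=> y /= /GH Hy; rewrite /xsection /= inE.
Qed.

End null_sets.

(** * The construction *)

(* [I] consists of the points whose initial segment is small for a well-order;
   were [I] small, the segment of the least point outside [I] would be small. *)
Lemma exists_large_with_small_segments (T : eqType) (small : set T -> Prop) :
  (forall A B, A `<=` B -> small B -> small A) ->
  (forall A x, small A -> small (A `|` [set x])) ->
  ~ small setT ->
  exists (le : T -> T -> Prop) (I : set T),
    [/\ forall i j, le i j \/ le j i, ~ small I &
        forall j, I j -> small [set i | le i j]].
Proof.
move=> smallS smallU1 largeT; have [le wo] := well_ordering_principle T.
have leP (A : set T) : A !=set0 -> exists2 m, A m & forall x, A x -> le m x.
  move=> [a Aa]; have [|m [[]]] := wo (fun x => `[< A x >]).
    by exists a; apply/asboolP.
  move=> /asboolP Am mmin _; exists m => // x Ax; apply: mmin; exact/asboolP.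
have le_total i j : le i j \/ le j i.
  have [|m [->|->] mij] := leP [set i; j]; first by exists i; left.
    by left; apply: mij; right.
  by right; apply: mij; left.
have le_refl i : le i i by have [] := le_total i i.
have le_anti : antisymmetric le.
  move=> i j /andP[ij ji]; have [|m [_ mP]] := wo (pred2 i j).
    by exists i; rewrite !inE eqxx.
  rewrite -(mP i) ?(mP j)//; split; rewrite ?inE ?eqxx ?orbT// => x.
    by rewrite !inE => /orP[]/eqP->.
  by rewrite !inE => /orP[]/eqP->.
pose I := [set j | small [set i | le i j]].
exists (fun i j => le i j), I; split => // smallI.
have [x nIx] : exists x, ~ I x.
  apply: contrapT => H; apply: largeT; apply: smallS smallI => x _.
  by apply: contrapT => nIx; apply: H; exists x.
have [|m nIm mmin] := leP (~` I); first by exists x.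
(* By minimality of [m], any point of its segment outside [I] is [m] itself. *)
apply: nIm; apply: smallS (smallU1 _ m smallI) => i /= im.
have [Ii|nIi] := pselect (I i); first by left.
by right; apply: le_anti; rewrite im mmin.
Qed.

Lemma negligible_outer_of_measure (R : realType) d (T : measurableType d)
    (mu : {measure set T -> \bar R}) (A : set T) :
  mu.-negligible A -> outer_of_measure mu A = 0%E.
Proof.
move=> [N [mN N0 AN]]; apply/eqP; rewrite eq_le; apply/andP; split.
  by rewrite -N0; apply: ereal_inf_lbound; exists N.
by apply: le_ereal_inf_tmp => _ [B _ <-]; exact: measure_ge0.
Qed.

(** * The Cantor measure *)

Section translates.
Variable R : realType.
Local Notation RR := (measurableTypeR R).
Local Notation unif := (uniform01 R).

HB.instance Definition _ := isMeasurableFun.Build _ _ RR RR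
  (@embed R : RR -> RR) (@measurable_embed R).

Definition cantor_measure : probability RR R :=
  distribution unif (@embed R : {mfun RR >-> RR}).

(** [extract] undoes [embed] almost everywhere. This reduces nullity for the Cantor measure to
    uniform nullity of an image, which is what smallness controls. *)
Lemma cantor_measure_negligible (A : set RR) :
  unif.-negligible (@extract R @` A) -> cantor_measure.-negligible A.
Proof.
move=> [N [mN N0 AN]]; exists (@extract R @^-1` N); split.
- by have := @measurable_extract R measurableT _ mN; rewrite setTI.
- have mE : measurable (@embed R @^-1` (@extract R @^-1` N) : set RR).
    have := @measurable_embed R measurableT (@extract R @^-1` N); rewrite setTI; apply.
    by have := @measurable_extract R measurableT _ mN; rewrite setTI.
  change (unif (@embed R @^-1` (@extract R @^-1` N)) = 0%E).
  apply: measure_negligible => //.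
  apply: (@negligibleS _ _ _ _ (N `|` ~` `[0, 1[)); last first.
    by apply: negligibleU; [exact/negligibleP|exact: unif_outside].
  move=> u /= Nu; have [u01|] := pselect (0 <= u < 1); last first.
    by move=> nu; right; rewrite /= in_itv.
  by left; rewrite -[u]embedK.
- by move=> v Av; apply: AN; exists v.
Qed.

(** The equation [embed (extract v) = v] is a Borel condition that puts [v] in the range of [embed],
    and by [embedK] it holds at [embed u] for [u] in [[0, 1)]. *)
Lemma cantor_measure_outside_range :
  cantor_measure.-negligible [set v | embed (extract v) != v].
Proof.
have mEE : measurable [set v : RR | embed (extract v) != v].
  rewrite (_ : [set v | _] = setT `&`
      (fun v : RR => embed (extract v) - v : RR) @^-1` (~` [set 0])).
    apply: measurable_funB => //; last exact: measurableC.
    apply: (measurableT_comp (@measurable_embed R)); exact: measurable_extract.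
  by rewrite setTI; apply/seteqP; split => v /=; rewrite -subr_eq0 => /eqP.
exists [set v | embed (extract v) != v]; split => //.
change (unif (@embed R @^-1` [set v : RR | embed (extract v) != v]) = 0%E).
apply: measure_negligible.
  by have := @measurable_embed R measurableT _ mEE; rewrite setTI.
apply: negligibleS (unif_outside R) => u /= + /[!in_itv]/= u01.
by rewrite embedK// eqxx.
Qed.

End translates.

Theorem theorem1p12 (R : realType) :
  exists (X : set R) (mu : probability (measurableTypeR R) R),
    (0 < lebesgue_outer X)%E /\
    forall t : R, outer_of_measure mu (translate X t) = 0%E.
Proof.
pose small (A : set R) := forall f : R -> R, (uniform01 R).-negligible (f @` A).
have null1 (a : R) : (uniform01 R).-negligible [set a].
  by exists [set a]; split => //; exact: unif_set1.
have [|||le [I [le_total largeI smallI]]] :=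
    @exists_large_with_small_segments R small.
- by move=> A B AB sB f; apply: negligibleS (sB f); exact: image_subset.
- by move=> A x sA f; rewrite image_setU image_set1; apply: negligibleU.
- move=> /(_ id); rewrite image_id => nT.
  have := measure_negligible (A := [set: measurableTypeR R]) measurableT nT.
  by move=> /(etrans (esym (probability_setT (uniform01 R))))[] /eqP; rewrite oner_eq0.
have [f If] : exists f : R -> R, ~ (uniform01 R).-negligible (f @` I).
  by apply: contrapT => H; apply: largeI => f; apply: contrapT => ?; apply: H; exists f.
(* [f] may repeat values: asking [i] to precede every [j] in [I] with [f j = y] keeps the indices
   paired with a given [y] in one initial segment. *)
pose first_copy y i := forall j, I j -> f j = y -> le i j.
pose X := [set z | exists i j, [/\ [/\ I i, I j & 0 <= f j], first_copy (f j) i,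
  ~ near_dyadic_io (interleave (f i) (f j)) & z = interleave (f i) (f j)]].
exists X, (cantor_measure R); split.
  rewrite lt_neqAle outer_measure_ge0 andbT; apply/eqP => /esym X0; apply: If.
  have /negligible_outer_measure {}X0 := X0.
  have := unif2_interleave_null (negligibleU X0 (near_dyadic_io_null R)).
  set N := _ `|` _ => /negligible_xsection[Z Z0 NZ].
  (* If [f] does not map [I] into the null set [Z], some [i] in [I] has a null section at [f i].
     Each [f j] then lies in that section, outside [[0, 1)], or in the image of the segment of [i]:
     failure of [first_copy] gives [j'] below [i] with the same value. *)
  have [ZI|] := pselect (f @` I `<=` Z); first exact: negligibleS Z0.
  move=> /existsNP[_] /not_implyP[[i Ii <-]] /NZ fi0.
  apply: (@negligibleS _ (measurableTypeR R) R (uniform01 R)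
    ([set y | N (interleave (f i) y)] `|`
      (~` `[0, 1[ `|` f @` [set j | le j i]))); last first.
    by apply: negligibleU => //; apply: negligibleU; [exact: unif_outside|exact: smallI].
  move=> _ [j Ij <-]; have [fj0|fj0] := pselect (0 <= f j < 1); last first.
    by right; left; rewrite /= in_itv.
  have [copy|] := pselect (first_copy (f j) i).
    left; rewrite /= /N; have [nd|nd] := pselect (near_dyadic_io (interleave (f i) (f j))).
      by right; rewrite /= ev_ge0 ev_le1.
    by left; exists i, j; split => //; split => //; have /andP[] := fj0.
  move=> /existsNP[j'] /not_implyP[Ij'] /not_implyP[ff nij'].
  by right; right; exists j' => //=; have [] := le_total i j'.
move=> t; apply: negligible_outer_of_measure.
have [F FP] := fiber_countable t.
(* [A n] covers the part of [X + t] in the range of [embed] whose square digits come from [F n]. *)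
pose A n := [set interleave (f i) (F n) + t | i in
  [set i | first_copy (F n) i /\ exists2 j, I j & f j = F n]].
apply: (@negligibleS _ (measurableTypeR R) R (cantor_measure R)
    ([set v | embed (extract v) != v] `|` \bigcup_n A n)).
  move=> _ [_ [i [j [[Ii Ij fj0] copy nd ->]]] <-].
  set v := _ + t; have [vE|vE] := eqVneq (embed (extract v)) v; last by left.
  have [n Fn] := FP _ _ _ fj0 nd (esym vE).
  by right; exists n => //; exists i; rewrite /= ?Fn//; split => //; exists j.
apply: negligibleU; first exact: cantor_measure_outside_range.
apply: negligible_bigcup => n; have [[j Ij fj]|none] := pselect (exists2 j, I j & f j = F n).
  apply: cantor_measure_negligible.
  (* All indices [i] involved precede [j], and with [F n] and [t] fixed the extracted code depends
     on [i] alone: this is why smallness quantifies over all maps. *)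
  apply: negligibleS (smallI j Ij (fun i => extract (interleave (f i) (F n) + t))).
  by move=> _ [v [i [copy _] <-] <-]; exists i => //=; exact: copy.
rewrite (_ : A n = set0); first exact: negligible_set0.
by apply/seteqP; split => // v [i [_ /none]].
Qed.
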